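(* Let $m\ge1$, $0<q<1$, $r,s\ge0$, $0\le n\le m$. The boundary map sending $f=A+\varepsilon_mB\in\mathcal M_{q;r,s}^n$ to the coefficients $(a_j)_{0\le j\le s}$, $(b_i)_{0\le i\le r}$ defined by $$A|_{z_m=0}=\sum_{j}w_m^{\langle j\rangle_q}a_j,\qquad B|_{w_m=0}=\sum_iz_m^{\langle i\rangle_q}b_i$$ is a linear isomorphism $$\mathcal M_{q;r,s}^n\longrightarrow\bigoplus_{j=0}^s\bigl(\ker\mathcal D_q'\cap\mathscr P_{m-1;r,s-j}^n\bigr)\oplus\bigoplus_{i=0}^r\bigl(\ker\mathcal D_q^{\dagger\prime}\cap\mathscr P_{m-1;r-i,s}^{n-1}\bigr).$$ In particular, $$\dim\mathcal M_{q;r,s}^n=\sum_{j=0}^s\dim\bigl(\ker\mathcal D_q'\cap\mathscr P_{m-1;r,s-j}^n\bigr)+\sum_{i=0}^r\dim\bigl(\ker\mathcal D_q^{\dagger\prime}\cap\mathscr P_{m-1;r-i,s}^{n-1}\bigr).$$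
   Context: $[r]_q=\frac{1-q^r}{1-q}$, $[r]_q!=\prod_{k=1}^r[k]_q$; $x^{\langle r\rangle_q}=x^r/[r]_q!$. $D_{q,x}f=\frac{f(\dots,qx,\dots)-f(\dots,x,\dots)}{(q-1)x}$. $\varepsilon_i$ is exterior multiplication by the $i$-th basis vector on $\bigwedge\mathbb C^m$, $\iota_i=\varepsilon_i^*$ contraction. $\mathcal D_q=\sum_{i=1}^m\varepsilon_iD_{q,z_i}$, $\mathcal D_q^\dagger=\sum_{i=1}^m\iota_iD_{q,w_i}$; primed operators $\mathcal D_q',\mathcal D_q^{\dagger\prime}$ are the same sums over $1\le i\le m-1$. $\mathscr P_{r,s}^n$ is the space of polynomials in $z_1,\dots,z_m,w_1,\dots,w_m$ of bidegree $(r,s)$ with values in $\bigwedge^n\mathbb C^m$, and $\mathscr P_{m-1;r,s}^n$ is the analogous space for the first $m-1$ coordinate pairs and $\bigwedge^n\mathbb C^{m-1}$ (zero if the spin degree is invalid). $\mathcal M_{q;r,s}^n=\ker\mathcal D_q\cap\ker\mathcal D_q^\dagger\cap\mathscr P_{r,s}^n$. Each $f$ is uniquely $A+\varepsilon_mB$ with $A,B$ polynomials in all $2m$ variables with values in $\bigwedge\mathbb C^{m-1}$ (first $m-1$ basis vectors). *)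

(* Defs.v *)
From HB Require Import structures.
From mathcomp Require Import all_boot all_order all_algebra.
From mathcomp Require Import reals complex.
From mathcomp.multinomials Require Import mpoly.

Set Implicit Arguments.
Unset Strict Implicit.
Unset Printing Implicit Defensive.

Import Order.TTheory GRing.Theory Num.Theory.
Local Open Scope ring_scope.

(* Polynomials in z_1, ..., z_k, w_1, ..., w_k with values in the exterior
   algebra of C^m: f I is the coefficient of e_I, the wedge product of the
   e_j (j in I) in increasing order. *)
Notation extpoly C k m := {ffun {set 'I_m} -> {mpoly C[k + k]}}.

Section QCalculus.
Variables (C : fieldType) (N : nat).
Implicit Types (p : {mpoly C[N]}) (i : 'I_N) (q : C).

Definition qnum q (r : nat) : C := (1 - q ^+ r) / (1 - q).
Definition qfact q (r : nat) : C := \prod_(1 <= k < r.+1) qnum q k.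
Definition qdivpow q (x : {mpoly C[N]}) (r : nat) : {mpoly C[N]} :=
  (qfact q r)^-1 *: x ^+ r.

(* p(..., c * x_i, ...) *)
Definition dilate (c : C) i p : {mpoly C[N]} :=
  p \mPo [tuple (if j == i then c *: 'X_j else 'X_j) | j < N].

(* Quotient of p by x_i (the monomials without x_i are dropped). *)
Definition quoX i p : {mpoly C[N]} :=
  \sum_(k <- msupp p | (0 < k i)%N) p@_k *: 'X_[k - U_(i)].

Definition qderiv q i p : {mpoly C[N]} :=
  (q - 1)^-1 *: quoX i (dilate q i p - p).

Lemma mul_quoX i p :
  (forall k : 'X_{1..N}, k i = 0%N -> p@_k = 0) -> 'X_i * quoX i p = p.
Proof.
move=> p0; rewrite /quoX mulr_sumr [RHS]mpolyE [RHS](bigID (fun k : 'X_{1..N} => 0 < k i)%N) /=.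
rewrite [X in _ = _ + X]big1 ?addr0; last first.
  by move=> k; rewrite -eqn0Ngt => /eqP /p0 ->; rewrite scale0r.
apply: eq_bigr => k ki; rewrite -scalerAr -mpolyXD addmC submK //.
by apply/mnm_lepP => j; rewrite mnm1E; case: eqP => [<-|].
Qed.

Lemma dilateE c i p :
  dilate c i p = \sum_(k <- msupp p) (c ^+ k i * p@_k) *: 'X_[k] :> {mpoly C[N]}.
Proof.
rewrite /dilate {1}[p]mpolyE linear_sum /=; apply: eq_bigr => k _.
rewrite linearZ /= comp_mpolyX mulrC -scalerA; congr (_ *: _).
rewrite [in RHS]mpolyXE_id (bigD1 i) //= [in RHS](bigD1 i) //= !tnth_mktuple eqxx.
rewrite exprZn -scalerAl; congr (_ *: (_ * _)).
by apply: eq_bigr => j /negbTE ji; rewrite tnth_mktuple ji.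
Qed.

(* qderiv is the q-difference quotient (f(qx) - f(x)) / ((q - 1) x). *)
Lemma qderivP q i p : q != 1 ->
  ((q - 1) *: 'X_i) * qderiv q i p = dilate q i p - p.
Proof.
move=> q1; rewrite /qderiv -scalerAr -scalerAl scalerA mulVf ?subr_eq0 // scale1r.
apply: mul_quoX => k ki; rewrite mcoeffB dilateE raddf_sum /=.
apply/eqP; rewrite subr_eq0; apply/eqP.
rewrite [X in _ = X@_k]mpolyE raddf_sum /=; apply: eq_bigr => l _.
rewrite !mcoeffZ mcoeffX; case: eqP => [->|]; last by rewrite !mulr0.
by rewrite ki expr0 mul1r.
Qed.

End QCalculus.

Section Forms.
Variable C : numClosedFieldType.

Definition zvar k (i : 'I_k) : 'I_(k + k) := lshift k i.
Definition wvar k (i : 'I_k) : 'I_(k + k) := rshift k i.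

(* Coefficient of e_I in the wedge product of e_i and e_J. *)
Definition ext_coef m (i : 'I_m) (I J : {set 'I_m}) : C :=
  if (i \notin J) && (I == i |: J) then (-1) ^+ #|[set j in J | (j < i)%N]|
  else 0.

Definition ext k m (i : 'I_m) (f : extpoly C k m) : extpoly C k m :=
  [ffun I => \sum_J ext_coef i I J *: f J].

(* The adjoint of ext for the inner product making (e_I)_I orthonormal. *)
Definition contr k m (i : 'I_m) (f : extpoly C k m) : extpoly C k m :=
  [ffun I => \sum_J (ext_coef i J I)^* *: f J].

Definition qDirac (q : C) m (f : extpoly C m m) : extpoly C m m :=
  \sum_(i < m) ext i [ffun I => qderiv q (zvar i) (f I)].
Definition qDiracDag (q : C) m (f : extpoly C m m) : extpoly C m m :=
  \sum_(i < m) contr i [ffun I => qderiv q (wvar i) (f I)].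

Definition bihomog m (r s : nat) (p : {mpoly C[m + m]}) : Prop :=
  forall k : 'X_{1..m + m}, k \in msupp p ->
    (\sum_(i < m) k (zvar i))%N = r /\ (\sum_(i < m) k (wvar i))%N = s.

(* The degree n is an integer, so that the space is 0 for n = -1. *)
Definition in_P m (n : int) (r s : nat) (f : extpoly C m m) : Prop :=
  forall I : {set 'I_m},
    bihomog r s (f I) /\ (f I != 0 -> (#|I|)%:Z = n).

Definition in_kerD q m n r s (f : extpoly C m m) : Prop :=
  qDirac q f = 0 /\ in_P n r s f.
Definition in_kerDdag q m n r s (f : extpoly C m m) : Prop :=
  qDiracDag q f = 0 /\ in_P n r s f.
Definition in_M q m n r s (f : extpoly C m m) : Prop :=
  [/\ qDirac q f = 0, qDiracDag q f = 0 & in_P n r s f].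

(* Pushforward along C^m -> C^(m+1), onto the first m basis vectors. *)
Definition incl k m (g : extpoly C k m) : extpoly C k m.+1 :=
  [ffun I : {set 'I_m.+1} =>
     if ord_max \in I then 0 else g (lift ord_max @^-1: I)].

(* Polynomials in the first m coordinate pairs, seen in all m+1 of them. *)
Definition emb m (p : {mpoly C[m + m]}) : {mpoly C[m.+1 + m.+1]} :=
  p \mPo [tuple match split j with
                | inl i => 'X_(zvar (lift ord_max i))
                | inr i => 'X_(wvar (lift ord_max i))
                end | j < m + m].

(* The families (a_j)_(0 <= j <= s) and (b_i)_(0 <= i <= r). *)
Definition bdata m (r s : nat) : lmodType C :=
  ({ffun 'I_s.+1 -> extpoly C m m} * {ffun 'I_r.+1 -> extpoly C m m})%type.

Definition boundary_data q m r s (f : extpoly C m.+1 m.+1)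
    (ab : bdata m r s) : Prop :=
  exists A B : extpoly C m.+1 m,
  [/\ f = incl A + ext ord_max (incl B),
      forall I, dilate 0 (zvar ord_max) (A I) =
        \sum_(j < s.+1) qdivpow q 'X_(wvar ord_max) j * emb (ab.1 j I)
    & forall I, dilate 0 (wvar ord_max) (B I) =
        \sum_(i < r.+1) qdivpow q 'X_(zvar ord_max) i * emb (ab.2 i I)].

Definition boundary_target q m (n : int) r s (ab : bdata m r s) : Prop :=
  (forall j : 'I_s.+1, in_kerD q n r (s - j) (ab.1 j)) /\
  (forall i : 'I_r.+1, in_kerDdag q (n - 1) (r - i) s (ab.2 i)).

End Forms.

Section LinearAlgebra.
Variables (K : fieldType) (V W : lmodType K).

Definition linear_iso (P : V -> Prop) (Q : W -> Prop) (phi : {linear V -> W})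
    : Prop :=
  [/\ forall v, P v -> Q (phi v),
      forall u v, P u -> P v -> phi u = phi v -> u = v
    & forall w, Q w -> exists2 v, P v & phi v = w].

(* The vectors satisfying P form a subspace of dimension d. *)
Definition has_dim (P : V -> Prop) (d : nat) : Prop :=
  exists b : 'I_d -> V,
    (forall c : 'I_d -> K, \sum_i c i *: b i = 0 -> forall i, c i = 0) /\
    (forall v, P v <-> exists c : 'I_d -> K, v = \sum_i c i *: b i).

End LinearAlgebra.

(* Main.v *)
Require Import Defs.
From HB Require Import structures.
From mathcomp Require Import all_boot all_order all_algebra.
From mathcomp Require Import boolp reals complex.
From mathcomp.multinomials Require Import mpoly.

Set Implicit Arguments.
Unset Strict Implicit.
Unset Printing Implicit Defensive.

Import Order.TTheory GRing.Theory Num.Theory.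
Local Open Scope ring_scope.

(* Write [f = A + e_max B] and expand [A] and [B] in the divided powers
   [z_max^<i> w_max^<j>], with coefficients [A_(i,j)] and [B_(i,j)] in the
   remaining variables. Then [D f = 0] says that [D' A_(i,j) = 0] and
   [A_(i+1,j) = D' B_(i,j)], while [D^+ f = 0] says that [D'^+ B_(i,j) = 0] and
   [B_(i,j+1) = - D'^+ A_(i,j)]. Hence the boundary data [A_(0,j)], [B_(i,0)]
   determine all coefficients by recursion, and since [D'^2 = (D'^+)^2 = 0] the
   only constraints on them are [D' A_(0,j) = 0] and [D'^+ B_(i,0) = 0]. *)

(** Divided powers are chosen because D_q x^<i+1> = x^<i>: a q-derivative in z_max or w_max becomes
    a bare shift of i or j, while the other derivatives act on each coefficient separately. This
    requires [k]_q != 0 for k >= 1, which 0 < q < 1 supplies. The first recursion carries no sign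
    because e_a e_max = - e_max e_a. Each A_(i,j) with i > 0 and each B_(i,j) with j > 0 is
    prescribed by exactly one equation, through a part whose i + j is smaller by one. So the
    recursion is well founded and meets no compatibility condition between D' and D'^+. The part
    (i,j) has bidegree (r - i, s - j), hence vanishes for i > r or j > s, and the parts add up to a
    polynomial. For the dimension formula, the spaces are predicates on modules of all polynomials,
    so the existence of finite bases has to be proved too; it follows from the bound on the
    degrees. *)

(** * Finite-dimensional subspaces given by predicates *)

Section Dimension.
Variable K : fieldType.

Definition subspace (V : lmodType K) (P : V -> Prop) : Prop :=
  P 0 /\ forall (a : K) u v, P u -> P v -> P (a *: u + v).

Lemma subspace_sum (V : lmodType K) (P : V -> Prop) d (c : 'I_d -> K) (b : 'I_d -> V) :
  subspace P -> (forall i, P (b i)) -> P (\sum_i c i *: b i).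
Proof.
move=> [P0 PZD] Pb; elim/big_rec: _ => // i v _ Pv; exact: PZD.
Qed.

(** [has_dim] makes [P] exactly the span of a family, so closure under linear combinations comes
    with it. *)
Lemma has_dim_subspace (V : lmodType K) (P : V -> Prop) d :
  has_dim P d -> subspace P.
Proof.
move=> [b [_ Pb]]; split.
  by apply/Pb; exists (fun=> 0); rewrite big1 // => i _; rewrite scale0r.
move=> a u v /Pb[c ->] /Pb[c' ->]; apply/Pb; exists (fun i => a * c i + c' i).
rewrite scaler_sumr -big_split /=; apply: eq_bigr => i _.
by rewrite scalerDl scalerA.
Qed.

(* The dimension is the largest size of a family in [P] with free image. *)
Lemma has_dim_exists (V : lmodType K) (P : V -> Prop) D (phi : {linear V -> 'rV[K]_D}) :
    subspace P -> (forall v, P v -> phi v = 0 -> v = 0) ->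
  exists d, has_dim P d.
Proof.
move=> subP phi_inj; have [P0 PZD] := subP.
pose free_family d := `[< exists b : 'I_d -> V, (forall i, P (b i)) /\
  row_free (\matrix_i phi (b i)) >].
have ex0 : exists d, free_family d.
  exists 0%N; apply/asboolP; exists (fun=> 0); split=> //.
  by rewrite /row_free flatmx0 mxrank0.
have le_D d : free_family d -> (d <= D)%N.
  move=> /asboolP[b [_]]; rewrite /row_free => /eqP <-; exact: rank_leq_col.
case: (ex_maxnP ex0 le_D) => d /asboolP[b [Pb freeb]] max_d; exists d, b.
have phi_sum (c : 'I_d -> K) :
    phi (\sum_i c i *: b i) = (\row_i c i) *m \matrix_i phi (b i).
  rewrite linear_sum mulmx_sum_row; apply: eq_bigr => i _.
  by rewrite linearZ rowK mxE.
split=> [c c0 i|v].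
  have: (\row_i c i) *m \matrix_i phi (b i) = 0 *m \matrix_i phi (b i).
    by rewrite -phi_sum c0 linear0 mul0mx.
  by move/(row_free_inj freeb)/rowP/(_ i); rewrite !mxE.
split=> [Pv|[c ->]]; last exact: subspace_sum.
have [/submxP[c Ec]|nsub] := boolP (phi v <= \matrix_i phi (b i))%MS.
  exists (fun i => c 0 i); apply/eqP; rewrite -subr_eq0; apply/eqP/phi_inj.
    by rewrite addrC -scaleN1r; apply: PZD => //; apply: subspace_sum.
  rewrite linearB phi_sum /= Ec; apply/eqP; rewrite subr_eq0; apply/eqP.
  by congr (_ *m _); apply/rowP => i; rewrite mxE.
(* Here [v] would extend the family, against maximality: [phi v] has rank 1, so if its line met the
   row space of the family nontrivially, it would lie in it. *)
have free_col : row_free (col_mx (phi v) (\matrix_i phi (b i))).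
  rewrite /row_free -addsmxE; apply/eqP.
  have := mxrank_sum_cap (phi v) (\matrix_i phi (b i)).
  rewrite (eqP freeb); have v0 : phi v != 0 by apply: contra nsub => /eqP->; apply: sub0mx.
  have -> : \rank (phi v) = 1%N.
    by rewrite rank_rV v0.
  suff /eqP-> : \rank (phi v :&: \matrix_i phi (b i))%MS == 0%N by rewrite addn0.
  rewrite mxrank_eq0; apply: contraNT nsub => cap0.
  have lecap := capmxSl (phi v) (\matrix_i phi (b i)).
  have/eqmxP/eqmx_sym : (phi v :&: \matrix_i phi (b i) == phi v)%MS.
    rewrite -mxrank_leqif_eq // eqn_leq mxrankS //= rank_rV v0 lt0n mxrank_eq0 //.
  by move=> ->; apply: capmxSr.
suff /max_d : free_family d.+1 by rewrite ltnn.
apply/asboolP; exists (fun i : 'I_d.+1 => oapp b v (unlift ord0 i)); split.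
  by move=> i; case: unliftP => [j|] _ /=.
have E : \matrix_(i < 1 + d) phi (oapp b v (unlift ord0 i)) =
    col_mx (phi v) (\matrix_i phi (b i)).
  apply/row_matrixP => i; rewrite rowK; case: (splitP i) => j Ej.
    have -> : i = lshift d j by apply/val_inj.
    rewrite rowKu row_id [j]ord1; rewrite (_ : lshift d 0 = ord0) ?unlift_none //.
    exact/val_inj.
  have -> : i = lift ord0 j by apply/val_inj; rewrite /= Ej.
  rewrite liftK /=; have -> : lift ord0 j = rshift 1 j by apply/val_inj.
  by rewrite rowKd rowK.
by rewrite E; exact: free_col.
Qed.

(** Preimages of a basis of [Q] form a basis of [P]. Since [phi] is injective on [P] only, their
    combinations must stay in [P], hence the assumption [subspace P]. *)
Lemma has_dim_iso (V W : lmodType K) (P : V -> Prop) (Q : W -> Prop)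
    (phi : {linear V -> W}) d :
  subspace P -> linear_iso P Q phi -> has_dim Q d -> has_dim P d.
Proof.
move=> subP [PQ phi_inj phi_surj] [b [bfree bQ]].
have Qb i : Q (b i).
  apply/bQ; exists (fun j => (j == i)%:R).
  rewrite (bigD1 i) //= eqxx scale1r big1 ?addr0 // => j /negbTE ->.
  by rewrite scale0r.
pose b' i := s2val (cid2 (phi_surj _ (Qb i))).
have Pb' i : P (b' i) by rewrite /b'; case: cid2.
have phib' i : phi (b' i) = b i by rewrite /b'; case: cid2.
have phi_sum c : phi (\sum_i c i *: b' i) = \sum_i c i *: b i.
  by rewrite linear_sum; apply: eq_bigr => i _; rewrite linearZ /= phib'.
exists b'; split=> [c c0 i|v]; first by apply: bfree; rewrite -phi_sum c0 linear0.
split=> [Pv|[c ->]]; last exact: subspace_sum.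
have /bQ[c Ec] := PQ _ Pv; exists c; apply: phi_inj => //; first exact: subspace_sum.
by rewrite phi_sum.
Qed.

Lemma has_dim_pair (V W : lmodType K) (P : V -> Prop) (Q : W -> Prop) d e :
  has_dim P d -> has_dim Q e ->
  has_dim (fun vw : V * W => P vw.1 /\ Q vw.2) (d + e)%N.
Proof.
move=> [b [bfree bP]] [b' [b'free b'Q]].
exists (fun i => match split i with inl j => (b j, 0) | inr j => (0, b' j) end).
have sumE c : \sum_(i < d + e) c i *:
      match split i with inl j => (b j, 0) | inr j => (0, b' j) end =
    (\sum_j c (lshift e j) *: b j, \sum_j c (rshift d j) *: b' j).
  rewrite big_split_ord /=.
  under eq_bigr => j _ do rewrite (unsplitK (inl j)).
  under [X in _ + X]eq_bigr => j _ do rewrite (unsplitK (inr j)).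
  rewrite [LHS]surjective_pairing; congr (_, _).
    rewrite /= !raddf_sum /= [X in _ + X]big1 ?addr0 // => j _; exact: scaler0.
  rewrite /= !raddf_sum /= [X in X + _]big1 ?add0r // => j _; exact: scaler0.
split=> [c|[v w]].
  rewrite sumE => -[c1 c2] i; case: (split_ordP i) => j ->.
    exact: (bfree (fun j => c (lshift e j))).
  exact: (b'free (fun j => c (rshift d j))).
split=> [[/= /bP[c ->] /b'Q[c' ->]]|[c]].
  exists (fun i => match split i with inl j => c j | inr j => c' j end).
  rewrite sumE; congr (_, _); apply: eq_bigr => j _.
    by rewrite (unsplitK (inl j)).
  by rewrite (unsplitK (inr j)).
rewrite sumE => -[-> ->] /=; split; first by apply/bP; exists (fun j => c (lshift e j)).
by apply/b'Q; exists (fun j => c (rshift d j)).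
Qed.

(** This handles the two finite direct sums of the target. Induction on [n]: splitting off the value
    at [ord0] is an isomorphism onto a pair, to which [has_dim_pair] applies. *)
Lemma has_dim_ffun (V : lmodType K) n (P : 'I_n -> V -> Prop) (d : 'I_n -> nat) :
  (forall i, has_dim (P i) (d i)) ->
  has_dim (fun f : {ffun 'I_n -> V} => forall i, P i (f i)) (\sum_i d i)%N.
Proof.
elim: n P d => [|n IHn] P d dP.
  rewrite big_ord0; exists (fun=> 0); split=> [c _ []//|f].
  split=> _; last by case.
  by exists (fun=> 0); apply/ffunP; case.
have dP' := has_dim_pair (dP ord0) (IHn _ _ (fun i => dP (lift ord0 i))).
pose split_fun (f : {ffun 'I_n.+1 -> V}) : V * {ffun 'I_n -> V} :=
  (f ord0, [ffun i => f (lift ord0 i)]).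
have split_lin : linear split_fun.
  move=> a f g; congr (_, _); first by rewrite !ffunE.
  by apply/ffunP => i; rewrite !ffunE.
pose phi : {linear {ffun 'I_n.+1 -> V} -> (V * {ffun 'I_n -> V})%type} :=
  HB.pack split_fun 
      (GRing.isLinear.Build K {ffun 'I_n.+1 -> V} (V * {ffun 'I_n -> V})%type *:%R
         split_fun split_lin).
rewrite big_ord_recl; apply: (has_dim_iso (phi := phi)) dP'.
  split=> [i|a f g Pf Pg i]; first by rewrite ffunE; case: (has_dim_subspace (dP i)).
  by rewrite !ffunE; case: (has_dim_subspace (dP i)) => _; apply.
split=> [f Pf|f g _ _ [E0 /ffunP E]|[v f] /= [Pv Pf]].
- by split=> [|i]; rewrite /= ?ffunE.
- apply/ffunP => i; case: (unliftP ord0 i) => [j|] -> //.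
  by have := E j; rewrite !ffunE.
- exists [ffun i => oapp f v (unlift ord0 i)].
    by move=> i; rewrite ffunE; case: unliftP => [j|] ->.
  rewrite /= /split_fun ffunE unlift_none /=; congr (_, _).
  by apply/ffunP => i; rewrite !ffunE liftK.
Qed.

End Dimension.

(** * Coefficients of dilations and q-derivatives *)

Section QDerivative.
Variables (C : fieldType) (N : nat).
Implicit Types (p : {mpoly C[N]}) (i : 'I_N) (q : C) (k : 'X_{1..N}).

(** The operators on polynomials are sums over [msupp]; this extracts one coefficient from such a
    sum. The second hypothesis covers a [k0] outside the support. *)
Lemma sum_msupp_only1 (V : nmodType) p k0 (F : 'X_{1..N} -> V) :
    (forall k, k != k0 -> F k = 0) -> (p@_k0 = 0 -> F k0 = 0) ->
  \sum_(k <- msupp p) F k = F k0.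
Proof.
move=> F0 Fk0; have [k0p|k0p] := boolP (k0 \in msupp p).
  rewrite (bigD1_seq k0) ?msupp_uniq //= big1 ?addr0 //.
rewrite big1_seq ?Fk0 //; first by apply/eqP; rewrite mcoeff_eq0.
by move=> k /= kp; apply: F0; apply: contraNneq k0p => <-.
Qed.

Lemma mcoeff_dilate q i p k : (dilate q i p)@_k = q ^+ k i * p@_k.
Proof.
rewrite dilateE raddf_sum /= (@sum_msupp_only1 _ _ k) => [|l lk|pk].
- by rewrite mcoeffZ mcoeffX eqxx mulr1.
- by rewrite mcoeffZ mcoeffX (negbTE lk) mulr0.
- by rewrite pk mulr0 scale0r mcoeff0.
Qed.

Lemma mcoeff_quoX i p k : (quoX i p)@_k = p@_(k + U_(i)).
Proof.
rewrite /quoX raddf_sum big_mkcond /= (@sum_msupp_only1 _ _ (k + U_(i))%MM).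
- by rewrite mnmDE mnm1E eqxx addn1 /= mcoeffZ mcoeffX addmK eqxx mulr1.
- move=> l lk; case: ifP => // li; rewrite mcoeffZ mcoeffX.
  have [E|] := eqVneq; last by rewrite mulr0.
  case/eqP: lk; rewrite -E submK //.
  by apply/mnm_lepP => j; rewrite mnm1E; case: eqP => [<-|].
- by move=> ->; rewrite scale0r mcoeff0 if_same.
Qed.

(** All later facts on [qderiv] (linearity, commutation, action on slices) are read off from this
    coefficient formula. *)
Lemma mcoeff_qderiv q i p k :
  (qderiv q i p)@_k = qnum q (k i).+1 * p@_(k + U_(i)).
Proof.
rewrite /qderiv mcoeffZ mcoeff_quoX mcoeffB mcoeff_dilate mnmDE mnm1E eqxx addn1.
rewrite -[X in _ * (_ - X)]mul1r -mulrBl mulrA; congr (_ * _).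
by rewrite /qnum -[1 - _]opprB -[1 - q]opprB invrN mulrNN mulrC.
Qed.

Fact qderiv_is_linear q i : linear (@qderiv C N q i).
Proof.
move=> a p p'; apply/mpolyP => k.
by rewrite mcoeffD mcoeffZ !mcoeff_qderiv mcoeffD mcoeffZ mulrDr mulrCA.
Qed.
HB.instance Definition _ q i :=
  GRing.isLinear.Build C {mpoly C[N]} {mpoly C[N]} *:%R (@qderiv C N q i)
    (@qderiv_is_linear q i).

Lemma qderiv_comm q i j p : qderiv q i (qderiv q j p) = qderiv q j (qderiv q i p).
Proof.
have [->//|ij] := eqVneq i j.
apply/mpolyP => k; rewrite !mcoeff_qderiv !mnmDE !mnm1E [j == i]eq_sym (negbTE ij).
by rewrite !addn0 mulrCA -addmA [(U_(i) + _)%MM]addmC addmA.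
Qed.

End QDerivative.

Lemma qfactS (C : fieldType) (q : C) r : qfact q r.+1 = qfact q r * qnum q r.+1.
Proof. by rewrite /qfact big_nat_recr. Qed.

Lemma big_zwvar (T : Type) (idx : T) (op : Monoid.law idx) n (F : 'I_(n + n) -> T) :
  \big[op/idx]_t F t =
    op (\big[op/idx]_(a < n) F (zvar a)) (\big[op/idx]_(a < n) F (wvar a)).
Proof. exact: big_split_ord. Qed.

Lemma big_lift_max (T : Type) (idx : T) (op : Monoid.law idx) n (F : 'I_n.+1 -> T) :
  \big[op/idx]_a F a = op (\big[op/idx]_(a < n) F (lift ord_max a)) (F ord_max).
Proof.
rewrite big_ord_recr; congr (op _ _); apply: eq_bigr => a _; congr F.
exact/val_inj/esym/lift_max.
Qed.

(** * Expansion in divided powers of z_max and w_max *)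

Section Slices.
Variables (C : numClosedFieldType) (m : nat) (q : C).
Hypothesis qnumS_neq0 : forall k, qnum q k.+1 != 0.
Local Notation M := m.+1.
Implicit Types (p : {mpoly C[M + M]}) (g : {mpoly C[m + m]}) (K : 'X_{1..M + M})
  (k : 'X_{1..m + m}) (i j : nat).

Lemma qfact_neq0 r : qfact q r != 0.
Proof.
by elim: r => [|r IHr]; [rewrite /qfact big_nil oner_eq0 | rewrite qfactS mulf_neq0].
Qed.

(** With [resmon], this identifies an exponent in all variables with a triple: the exponents of
    z_max and w_max, and an exponent in the remaining variables. *)
Definition extmon i j k : 'X_{1..M + M} :=
  [multinom match split t with
            | inl a => oapp (fun a' => k (zvar a')) i (unlift ord_max a)
            | inr a => oapp (fun a' => k (wvar a')) j (unlift ord_max a)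
            end | t < M + M].

Definition resmon K : 'X_{1..m + m} :=
  [multinom match split t with
            | inl a => K (zvar (lift ord_max a))
            | inr a => K (wvar (lift ord_max a))
            end | t < m + m].

Local Notation zM := (zvar (@ord_max m)).
Local Notation wM := (wvar (@ord_max m)).

Lemma split_zvar n (a : 'I_n) : split (zvar a) = inl a.
Proof. exact: (unsplitK (inl _)). Qed.
Lemma split_wvar n (a : 'I_n) : split (wvar a) = inr a.
Proof. exact: (unsplitK (inr _)). Qed.

Lemma extmon_zmax i j k : extmon i j k zM = i.
Proof. by rewrite mnmE split_zvar unlift_none. Qed.
Lemma extmon_wmax i j k : extmon i j k wM = j.
Proof. by rewrite mnmE split_wvar unlift_none. Qed.
Lemma extmon_zlift i j k a : extmon i j k (zvar (lift ord_max a)) = k (zvar a).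
Proof. by rewrite mnmE split_zvar liftK. Qed.
Lemma extmon_wlift i j k a : extmon i j k (wvar (lift ord_max a)) = k (wvar a).
Proof. by rewrite mnmE split_wvar liftK. Qed.
Lemma resmon_z K a : resmon K (zvar a) = K (zvar (lift ord_max a)).
Proof. by rewrite mnmE split_zvar. Qed.
Lemma resmon_w K a : resmon K (wvar a) = K (wvar (lift ord_max a)).
Proof. by rewrite mnmE split_wvar. Qed.

Lemma zwvar_ind n (P : 'I_(n + n) -> Prop) :
  (forall a, P (zvar a)) -> (forall a, P (wvar a)) -> forall t, P t.
Proof. by move=> Pz Pw t; rewrite -(splitK t); case: (split t). Qed.

Lemma zwvarS_ind (P : 'I_(M + M) -> Prop) : P zM -> P wM ->
  (forall a, P (zvar (lift ord_max a))) -> (forall a, P (wvar (lift ord_max a))) ->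
  forall t, P t.
Proof.
move=> Pz Pw Pzl Pwl; apply: zwvar_ind => a; case: (unliftP ord_max a) => [b|] -> //.
Qed.

Lemma eq_zvar n (a b : 'I_n) : (zvar a == zvar b) = (a == b).
Proof. exact: eq_lshift. Qed.
Lemma eq_wvar n (a b : 'I_n) : (wvar a == wvar b) = (a == b).
Proof. exact: eq_rshift. Qed.
Lemma eq_zwvar n (a b : 'I_n) : (zvar a == wvar b) = false.
Proof. exact: eq_lrshift. Qed.
Lemma eq_wzvar n (a b : 'I_n) : (wvar a == zvar b) = false.
Proof. exact: eq_rlshift. Qed.
Definition eq_zw := (eq_zvar, eq_wvar, eq_zwvar, eq_wzvar).
Definition extmonE :=
  (extmon_zmax, extmon_wmax, extmon_zlift, extmon_wlift, resmon_z, resmon_w).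

Lemma extmonK i j : cancel (extmon i j) resmon.
Proof. by move=> k; apply/mnmP; apply: zwvar_ind => a; rewrite !extmonE. Qed.

Lemma resmonK K : extmon (K zM) (K wM) (resmon K) = K.
Proof. by apply/mnmP; apply: zwvarS_ind => [||a|a]; rewrite !extmonE. Qed.

Lemma extmonDzmax i j k : (extmon i j k + U_(zM))%MM = extmon i.+1 j k.
Proof.
apply/mnmP; apply: zwvarS_ind => [||a|a]; rewrite mnmDE mnm1E !extmonE !eq_zw.
- by rewrite eqxx addn1.
- by rewrite addn0.
- by rewrite (negbTE (neq_lift _ _)) addn0.
- by rewrite addn0.
Qed.

Lemma extmonDwmax i j k : (extmon i j k + U_(wM))%MM = extmon i j.+1 k.
Proof.
apply/mnmP; apply: zwvarS_ind => [||a|a]; rewrite mnmDE mnm1E !extmonE !eq_zw.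
- by rewrite addn0.
- by rewrite eqxx addn1.
- by rewrite addn0.
- by rewrite (negbTE (neq_lift _ _)) addn0.
Qed.

Lemma extmonDzlift i j k a :
  (extmon i j k + U_(zvar (lift ord_max a)))%MM = extmon i j (k + U_(zvar a)).
Proof.
apply/mnmP; apply: zwvarS_ind => [||b|b]; rewrite mnmDE mnm1E !extmonE !eq_zw.
- by rewrite eq_sym (negbTE (neq_lift _ _)) addn0.
- by rewrite addn0.
- by rewrite mnmDE mnm1E !eq_zw (inj_eq lift_inj).
- by rewrite mnmDE mnm1E !eq_zw.
Qed.

Lemma extmonDwlift i j k a :
  (extmon i j k + U_(wvar (lift ord_max a)))%MM = extmon i j (k + U_(wvar a)).
Proof.
apply/mnmP; apply: zwvarS_ind => [||b|b]; rewrite mnmDE mnm1E !extmonE !eq_zw.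
- by rewrite addn0.
- by rewrite eq_sym (negbTE (neq_lift _ _)) addn0.
- by rewrite mnmDE mnm1E !eq_zw.
- by rewrite mnmDE mnm1E !eq_zw (inj_eq lift_inj).
Qed.

(* The coefficient of [z_max^<i> w_max^<j>] in [p]. *)
Definition slice i j p : {mpoly C[m + m]} :=
  \sum_(K <- msupp p)
    (if (K zM == i) && (K wM == j) then qfact q i * qfact q j * p@_K else 0)
      *: 'X_[resmon K].

Lemma mcoeff_slice i j p k :
  (slice i j p)@_k = qfact q i * qfact q j * p@_(extmon i j k).
Proof.
rewrite /slice raddf_sum /= (@sum_msupp_only1 _ _ _ _ (extmon i j k)).
- by rewrite !extmonE !eqxx mcoeffZ mcoeffX extmonK eqxx mulr1.
- move=> K neqK; rewrite mcoeffZ mcoeffX; case: ifP => [/andP[/eqP Ei /eqP Ej]|].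
    have [E|] := eqVneq; last by rewrite mulr0.
    by rewrite -Ei -Ej -E resmonK eqxx in neqK.
  by rewrite mul0r.
- by move=> ->; rewrite mulr0 if_same scale0r mcoeff0.
Qed.

Fact slice_is_linear i j : linear (slice i j).
Proof.
move=> a p p'; apply/mpolyP => k.
by rewrite mcoeffD mcoeffZ !mcoeff_slice mcoeffD mcoeffZ mulrDr mulrCA.
Qed.
HB.instance Definition _ i j :=
  GRing.isLinear.Build C {mpoly C[M + M]} {mpoly C[m + m]} *:%R (slice i j)
    (@slice_is_linear i j).

Lemma mcoeff_resmon p K :
  p@_K = (qfact q (K zM) * qfact q (K wM))^-1 * (slice (K zM) (K wM) p)@_(resmon K).
Proof.
rewrite mcoeff_slice resmonK mulrA mulVf ?mul1r //.
by rewrite mulf_neq0 ?qfact_neq0.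
Qed.

(** Every exponent is an [extmon] by [resmonK], and the factors [i]_q! [j]_q! are invertible, so the
    slices retain every coefficient. *)
Lemma slice_inj p p' : (forall i j, slice i j p = slice i j p') -> p = p'.
Proof. by move=> E; apply/mpolyP => K; rewrite !mcoeff_resmon E. Qed.

(** The factor [i+1]_q produced by the derivative is absorbed by [i+1]_q! = [i]_q! [i+1]_q, which
    leaves a pure shift. *)
Lemma slice_qderiv_zmax i j p : slice i j (qderiv q zM p) = slice i.+1 j p.
Proof.
apply/mpolyP => k; rewrite !mcoeff_slice mcoeff_qderiv extmonDzmax extmonE qfactS.
by rewrite mulrA; congr (_ * _); rewrite mulrAC.
Qed.

Lemma slice_qderiv_wmax i j p : slice i j (qderiv q wM p) = slice i j.+1 p.
Proof.
apply/mpolyP => k; rewrite !mcoeff_slice mcoeff_qderiv extmonDwmax extmonE qfactS.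
by rewrite !mulrA.
Qed.

Lemma slice_qderiv_zlift i j p a :
  slice i j (qderiv q (zvar (lift ord_max a)) p) = qderiv q (zvar a) (slice i j p).
Proof.
apply/mpolyP => k; rewrite !(mcoeff_slice, mcoeff_qderiv) extmonDzlift extmonE.
by rewrite mulrCA.
Qed.

Lemma slice_qderiv_wlift i j p a :
  slice i j (qderiv q (wvar (lift ord_max a)) p) = qderiv q (wvar a) (slice i j p).
Proof.
apply/mpolyP => k; rewrite !(mcoeff_slice, mcoeff_qderiv) extmonDwlift extmonE.
by rewrite mulrCA.
Qed.

Lemma emb_mpolyX k : emb 'X_[k] = 'X_[extmon 0 0 k] :> {mpoly C[M + M]}.
Proof.
rewrite /emb comp_mpolyX mpolyXE_id !big_zwvar /= !big_lift_max /= !extmonE.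
rewrite !expr0 !mulr1; congr (_ * _); apply: eq_bigr => a _.
  by rewrite tnth_mktuple split_zvar extmonE.
by rewrite tnth_mktuple split_wvar extmonE.
Qed.

(* [z_max^<i> w_max^<j> g], with [g] seen as a polynomial in the larger ring. *)
Definition unslice i j g : {mpoly C[M + M]} :=
  \sum_(k <- msupp g) ((qfact q i * qfact q j)^-1 * g@_k) *: 'X_[extmon i j k].

Lemma mcoeff_unslice i j g K : (unslice i j g)@_K =
  (if (K zM == i) && (K wM == j) then (qfact q i * qfact q j)^-1 * g@_(resmon K) else 0).
Proof.
rewrite /unslice raddf_sum /= (@sum_msupp_only1 _ _ _ _ (resmon K)).
- rewrite mcoeffZ mcoeffX; case: andP => [[/eqP<- /eqP<-]|NK].
    by rewrite resmonK eqxx mulr1.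
  case: eqP => [E|]; last by rewrite mulr0.
  by case: NK; rewrite -E !extmonE !eqxx.
- move=> k neqk; rewrite mcoeffZ mcoeffX; case: eqP => [E|]; last by rewrite mulr0.
  by rewrite -E extmonK eqxx in neqk.
- by move=> ->; rewrite mulr0 scale0r mcoeff0.
Qed.

Lemma slice_unslice i j i' j' g :
  slice i' j' (unslice i j g) = (if (i' == i) && (j' == j) then g else 0).
Proof.
apply/mpolyP => k; rewrite mcoeff_slice mcoeff_unslice !extmonE extmonK.
case: andP => [[/eqP-> /eqP->]|_]; last by rewrite mulr0 mcoeff0.
by rewrite mulrA mulfV ?mul1r // mulf_neq0 ?qfact_neq0.
Qed.

(** Dilation by 0 is restriction to z_max = 0; as [0 ^+ 0 = 1], the terms free of z_max survive
    unchanged. *)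
Lemma slice_dilate0z i j p : slice i j (dilate 0 zM p) = (if i == 0%N then slice i j p else 0).
Proof.
apply/mpolyP => k; rewrite mcoeff_slice mcoeff_dilate extmonE expr0n.
by case: eqP => _; rewrite ?mul1r ?mcoeff_slice ?mul0r ?mulr0 ?mcoeff0.
Qed.

Lemma slice_dilate0w i j p : slice i j (dilate 0 wM p) = (if j == 0%N then slice i j p else 0).
Proof.
apply/mpolyP => k; rewrite mcoeff_slice mcoeff_dilate extmonE expr0n.
by case: eqP => _; rewrite ?mul1r ?mcoeff_slice ?mul0r ?mulr0 ?mcoeff0.
Qed.

(** Turns the expansions in [boundary_data] into sums of [unslice], whose slices are known. The
    missing power of w_max contributes [0]_q! = 1. *)
Lemma qdivpowz_emb i g : qdivpow q 'X_zM i * emb g = unslice i 0 g.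
Proof.
rewrite [in LHS](mpolyE g) /emb linear_sum /= /unslice mulr_sumr.
apply: eq_bigr => k _; rewrite linearZ /= -/(emb _) emb_mpolyX /qdivpow.
rewrite -scalerAl -scalerAr scalerA {3}/qfact big_nil mulr1; congr (_ *: _).
elim: i => [|i IHi]; first by rewrite expr0 mul1r.
by rewrite exprSr -mulrA [X in _ * X]mulrC mulrA IHi -mpolyXD extmonDzmax.
Qed.

Lemma qdivpoww_emb j g : qdivpow q 'X_wM j * emb g = unslice 0 j g.
Proof.
rewrite [in LHS](mpolyE g) /emb linear_sum /= /unslice mulr_sumr.
apply: eq_bigr => k _; rewrite linearZ /= -/(emb _) emb_mpolyX /qdivpow.
rewrite -scalerAl -scalerAr scalerA {2}/qfact big_nil mul1r; congr (_ *: _).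
elim: j => [|j IHj]; first by rewrite expr0 mul1r.
by rewrite exprSr -mulrA [X in _ * X]mulrC mulrA IHj -mpolyXD extmonDwmax.
Qed.

End Slices.

(** Exchanging the two summations shows that the sum is its own opposite, and 2 is invertible. *)
Lemma sum_antisym (C : numFieldType) (V : lmodType C) n (T : 'I_n -> 'I_n -> V) :
  (forall a b, T a b = - T b a) -> \sum_a \sum_b T a b = 0.
Proof.
move=> Tanti; set S := LHS.
have : S = - S.
  by rewrite [in LHS]/S exchange_big -sumrN; apply: eq_bigr => a _;
     rewrite -sumrN; apply: eq_bigr => b _; rewrite Tanti.
move/eqP; rewrite -subr_eq0 opprK -mulr2n -scaler_nat scaler_eq0 pnatr_eq0 /=.
by move/eqP.
Qed.

(** * Signs and anticommutation in the exterior algebra *)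

Section Exterior.
Variables (C : numClosedFieldType) (k m : nat).
Implicit Types (f g : extpoly C k m) (a b : 'I_m) (I J : {set 'I_m}).

(** The sign of sorting e_a into e_I. The strict inequality makes it blind to whether [a] itself
    lies in [I]. *)
Definition esign n (a : 'I_n) (I : {set 'I_n}) : C := (-1) ^+ #|[set j in I | (j < a)%N]|.

Lemma esignU1 a b I : b \notin I -> esign a (b |: I) = (-1) ^+ (b < a)%N * esign a I.
Proof.
move=> bI; rewrite /esign; case: ltnP => ba /=.
  have -> : [set j in b |: I | (j < a)%N] = b |: [set j in I | (j < a)%N].
    by apply/setP => j; rewrite !inE; case: eqP => [->|].
  by rewrite cardsU1 inE (negbTE bI) exprD.
rewrite expr0 mul1r; congr (_ ^+ #|pred_of_set _|); apply/setP => j; rewrite !inE.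
by case: eqP => [->|] //=; rewrite ltnNge ba andbF.
Qed.

Lemma esignU1id a I : esign a (a |: I) = esign a I.
Proof.
rewrite /esign; congr (_ ^+ #|pred_of_set _|); apply/setP => j; rewrite !inE.
by case: eqP => [->|] //=; rewrite ltnn !andbF.
Qed.

Lemma esignD1id a I : esign a (I :\ a) = esign a I.
Proof.
rewrite /esign; congr (_ ^+ #|pred_of_set _|); apply/setP => j; rewrite !inE.
by case: eqP => [->|] //=; rewrite ltnn !andbF.
Qed.

(** Exactly one of [a < b] and [b < a] holds, so exactly one of the two enlarged sets flips its
    sign. *)
Lemma esign_swap a b I : a != b -> a \notin I -> b \notin I ->
  esign a I * esign b (a |: I) = - (esign b I * esign a (b |: I)).
Proof.
move=> ab aI bI; rewrite !esignU1 //; move: ab; rewrite -val_eqE neq_ltn.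
by case: ltngtP => //= _ _; rewrite !(expr0, expr1, mulN1r, mul1r, mulrN, opprK) mulrC.
Qed.

(** Row [I] of the matrix [ext_coef a] has at most one nonzero entry, at [I :\ a]. *)
Lemma extE a f I : ext a f I = if a \in I then esign a I *: f (I :\ a) else 0.
Proof.
rewrite ffunE; case: ifPn => aI.
  rewrite (bigD1 (I :\ a)) //= big1 ?addr0 => [|J JI].
    by rewrite /ext_coef setD11 setD1K // eqxx -esignD1id.
  rewrite /ext_coef; case: ifP => [/andP[aJ /eqP EI]|]; last by rewrite scale0r.
  by rewrite EI setU1K ?eqxx in JI.
rewrite big1 // => J _; rewrite /ext_coef; case: ifP => [/andP[_ /eqP EI]|].
  by rewrite EI setU11 in aI.
by rewrite scale0r.
Qed.

(** The entries of [ext_coef] are 0 or signs, hence fixed by conjugation: the adjoint is the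
    transpose, with at most one entry per row, at [a |: I]. *)
Lemma contrE a f I : contr a f I = if a \in I then 0 else esign a I *: f (a |: I).
Proof.
rewrite ffunE; case: ifPn => aI.
  by rewrite big1 // => J _; rewrite /ext_coef aI /= conjC0 scale0r.
rewrite (bigD1 (a |: I)) //= big1 ?addr0 => [|J JI].
  by rewrite /ext_coef aI eqxx rmorphXn /= rmorphN1.
by rewrite /ext_coef (negbTE JI) andbF conjC0 scale0r.
Qed.

Fact ext_is_linear a : linear (@ext C k m a).
Proof.
move=> c f g; apply/ffunP => I; rewrite [RHS]ffunE [X in _ = X + _]ffunE !extE !ffunE.
by case: ifP => _; rewrite ?scaler0 ?addr0 // scalerDr !scalerA mulrC.
Qed.
HB.instance Definition _ a :=
  GRing.isLinear.Build C (extpoly C k m) (extpoly C k m) *:%R (@ext C k m a)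
    (@ext_is_linear a).

Fact contr_is_linear a : linear (@contr C k m a).
Proof.
move=> c f g; apply/ffunP => I; rewrite [RHS]ffunE [X in _ = X + _]ffunE !contrE !ffunE.
by case: ifP => _; rewrite ?scaler0 ?addr0 // scalerDr !scalerA mulrC.
Qed.
HB.instance Definition _ a :=
  GRing.isLinear.Build C (extpoly C k m) (extpoly C k m) *:%R (@contr C k m a)
    (@contr_is_linear a).

Lemma ext_anticomm a b f : ext a (ext b f) = - ext b (ext a f).
Proof.
apply/ffunP => I; rewrite [RHS]ffunE !extE !in_setD1.
have [<-|ab] := eqVneq a b.
  by rewrite /= scaler0 if_same oppr0.
rewrite /=.
case: (boolP (a \in I)) => aI; case: (boolP (b \in I)) => bI;
  rewrite ?scaler0 ?oppr0 //.
rewrite !setDDl [b |: [set a]]setUC !scalerA -scaleNr; congr (_ *: _).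
(* Over [K], the set [I :\ a] is [b |: K] and [I :\ b] is [a |: K], so the two sign products become
   those of [esign_swap]. *)
set K := I :\: [set a; b].
have aK : a \notin K by rewrite !inE eqxx.
have bK : b \notin K by rewrite !inE eqxx orbT.
have IaE : I :\ a = b |: K.
  by apply/setP => c; rewrite !inE; case: (eqVneq c b) => [->|]; rewrite ?orbF //= eq_sym ab.
have IbE : I :\ b = a |: K.
  by apply/setP => c; rewrite !inE; case: (eqVneq c a) => [->|]; rewrite ?orbF //= ab.
rewrite -(esignD1id a) -(esignD1id b I) IaE IbE !esignU1id mulrC.
by rewrite [X in _ = - X]mulrC esign_swap // eq_sym.
Qed.

Lemma contr_anticomm a b f : contr a (contr b f) = - contr b (contr a f).
Proof.
apply/ffunP => I; rewrite [RHS]ffunE !contrE !in_setU1.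
have [<-|ab] := eqVneq a b.
  by rewrite /= scaler0 if_same oppr0.
rewrite /=.
case: (boolP (a \in I)) => aI; case: (boolP (b \in I)) => bI;
  rewrite ?scaler0 ?oppr0 //.
by rewrite !scalerA setUCA esign_swap // scaleNr.
Qed.

Definition qder (q : C) x f : extpoly C k m := [ffun I => qderiv q x (f I)].

End Exterior.

(** * The q-Dirac operators are linear and square to zero *)

Section QDirac.
Variables (C : numClosedFieldType) (q : C).

Fact qder_is_linear k m x : linear (@qder C k m q x).
Proof. by move=> c f g; apply/ffunP => I; rewrite !ffunE linearP. Qed.
HB.instance Definition _ k m x :=
  GRing.isLinear.Build C (extpoly C k m) (extpoly C k m) *:%R (@qder C k m q x)
    (@qder_is_linear k m x).

Lemma qderE k m x (f : extpoly C k m) I : qder q x f I = qderiv q x (f I).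
Proof. exact: ffunE. Qed.

Lemma qder_ext k m x (a : 'I_m) (f : extpoly C k m) :
  qder q x (ext a f) = ext a (qder q x f).
Proof.
apply/ffunP => I; rewrite qderE !extE qderE.
by case: ifP => _; rewrite ?linear0 // linearZ.
Qed.

Lemma qder_contr k m x (a : 'I_m) (f : extpoly C k m) :
  qder q x (contr a f) = contr a (qder q x f).
Proof.
apply/ffunP => I; rewrite qderE !contrE qderE.
by case: ifP => _; rewrite ?linear0 // linearZ.
Qed.

Lemma qder_comm k m x y (f : extpoly C k m) :
  qder q x (qder q y f) = qder q y (qder q x f).
Proof. 
apply/ffunP => I; rewrite [LHS]qderE [RHS]qderE.
rewrite [X in qderiv q x X]qderE [X in _ = qderiv q y X]qderE; exact: qderiv_comm.
 Qed.

Variable m : nat.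
Implicit Types f : extpoly C m m.

Lemma qDiracE f : qDirac q f = \sum_a ext a (qder q (zvar a) f).
Proof. by []. Qed.
Lemma qDiracDagE f : qDiracDag q f = \sum_a contr a (qder q (wvar a) f).
Proof. by []. Qed.

Fact qDirac_is_linear : linear (@qDirac C q m).
Proof.
move=> c f g; rewrite !qDiracE scaler_sumr -big_split /=.
by apply: eq_bigr => a _; rewrite !linearP.
Qed.
HB.instance Definition _ :=
  GRing.isLinear.Build C (extpoly C m m) (extpoly C m m) *:%R (@qDirac C q m)
    qDirac_is_linear.

Fact qDiracDag_is_linear : linear (@qDiracDag C q m).
Proof.
move=> c f g; rewrite !qDiracDagE scaler_sumr -big_split /=.
by apply: eq_bigr => a _; rewrite !linearP.
Qed.
HB.instance Definition _ :=
  GRing.isLinear.Build C (extpoly C m m) (extpoly C m m) *:%R (@qDiracDag C q m)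
    qDiracDag_is_linear.

(** The q-derivatives commute while the exterior multiplications anticommute, so the double sum is
    antisymmetric. *)
Lemma qDirac_qDirac f : qDirac q (qDirac q f) = 0.
Proof.
rewrite [X in qDirac q X]qDiracE linear_sum.
under eq_bigr => b _ do rewrite /= qDiracE.
apply: sum_antisym => b a.
by rewrite !qder_ext qder_comm ext_anticomm.
Qed.

Lemma qDiracDag_qDiracDag f : qDiracDag q (qDiracDag q f) = 0.
Proof.
rewrite [X in qDiracDag q X]qDiracDagE linear_sum.
under eq_bigr => b _ do rewrite /= qDiracDagE.
apply: sum_antisym => b a.
by rewrite !qder_contr qder_comm contr_anticomm.
Qed.

End QDirac.

(** * The Dirac equations in terms of the parts of A and B *)

Section Parts.
Variables (C : numClosedFieldType) (m : nat) (q : C).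
Hypothesis qnumS_neq0 : forall k, qnum q k.+1 != 0.
Local Notation M := m.+1.
Implicit Types (I : {set 'I_m}) (J : {set 'I_M}) (f : extpoly C M M) (b : bool) (i j : nat)
  (a : 'I_m).

(** Subsets of ['I_m.+1] correspond to pairs of a boolean, telling whether [ord_max] is a member,
    and a subset of ['I_m]; the inverse is in [topset_preim]. *)
Definition topset b I : {set 'I_M} :=
  [set t | oapp (fun a => a \in I) b (unlift ord_max t)].

Lemma in_topset_max b I : (ord_max \in topset b I) = b.
Proof. by rewrite inE unlift_none. Qed.
Lemma in_topset_lift b I a : (lift ord_max a \in topset b I) = (a \in I).
Proof. by rewrite inE liftK. Qed.
Definition in_topset := (in_topset_max, in_topset_lift).

Lemma setS_ext J J' : (ord_max \in J) = (ord_max \in J') ->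
  (forall a, (lift ord_max a \in J) = (lift ord_max a \in J')) -> J = J'.
Proof. by move=> Emax Elift; apply/setP => t; case: (unliftP ord_max t) => [a|] ->. Qed.

Lemma topsetD1 b I a : topset b (I :\ a) = topset b I :\ lift ord_max a.
Proof.
apply: setS_ext => [|c]; rewrite in_setD1 !in_topset ?neq_lift //.
by rewrite in_setD1 (inj_eq lift_inj).
Qed.

Lemma topsetU1 b I a : topset b (a |: I) = lift ord_max a |: topset b I.
Proof.
apply: setS_ext => [|c]; rewrite in_setU1 !in_topset ?(negbTE (neq_lift _ _)) //.
by rewrite in_setU1 (inj_eq lift_inj).
Qed.

Lemma topsetT_D1 I : topset true I :\ ord_max = topset false I.
Proof.
by apply: setS_ext => [|c]; rewrite in_setD1 !in_topset ?eqxx // eq_sym neq_lift.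
Qed.

Lemma topsetF_U1 I : ord_max |: topset false I = topset true I.
Proof.
apply: setS_ext => [|c]; rewrite in_setU1 !in_topset ?eqxx //.
by rewrite eq_sym (negbTE (neq_lift _ _)).
Qed.

Lemma topset_preim J : topset (ord_max \in J) (lift ord_max @^-1: J) = J.
Proof. by apply: setS_ext => [|c]; rewrite !in_topset // inE. Qed.

Lemma preim_topset b I : lift ord_max @^-1: topset b I = I.
Proof. by apply/setP => a; rewrite inE in_topset. Qed.

Lemma card_topset b I : #|topset b I| = (b + #|I|)%N.
Proof.
have cardF : #|topset false I| = #|I|.
  rewrite -(card_imset I (@lift_inj _ ord_max)); congr #|pred_of_set _|.
  apply: setS_ext => [|a]; rewrite in_topset.
    by apply/esym/imsetP => -[a _ /eqP]; rewrite (negbTE (neq_lift _ _)).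
  by rewrite mem_imset //; apply: lift_inj.
case: b => //; rewrite -topsetF_U1 cardsU1 in_topset cardF //.
Qed.

Lemma esign_topset_lift b I a : esign C (lift ord_max a) (topset b I) = esign C a I.
Proof.
rewrite /esign -[#|[set j in I | _]|](card_topset false); congr (_ ^+ #|pred_of_set _|).
apply: setS_ext => [|c]; rewrite inE !in_topset.
  by rewrite lift_max ltnNge ltnW //= andbF.
by rewrite inE !lift_max.
Qed.

Lemma esign_topset_max b I : esign C ord_max (topset b I) = (-1) ^+ #|I|.
Proof.
rewrite /esign -[#|I|](card_topset false); congr (_ ^+ #|pred_of_set _|).
apply: setS_ext => [|c]; rewrite inE !in_topset ?ltnn ?andbF //.
by rewrite lift_max /= ltn_ord andbT.
Qed.

(* In [f = A + e_max B], the slices of [A] (for [b = false]) and of [B] (for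
   [b = true]); the sign comes from [e_max e_I = (-1)^|I| e_I e_max]. *)
Definition part b i j f : extpoly C m m :=
  [ffun I : {set 'I_m} => slice q i j ((-1) ^+ (b * #|I|) *: f (topset b I))].

Fact part_is_linear b i j : linear (part b i j).
Proof.
move=> c f g; apply/ffunP => I; rewrite !ffunE -linearP; congr slice.
by rewrite scalerDr !scalerA mulrC.
Qed.
HB.instance Definition _ b i j :=
  GRing.isLinear.Build C (extpoly C M M) (extpoly C m m) *:%R (part b i j)
    (@part_is_linear b i j).

Lemma part_inj f g : (forall b i j, part b i j f = part b i j g) -> f = g.
Proof.
move=> E; apply/ffunP => J; rewrite -(topset_preim J).
set b := _ \in _; set I := _ @^-1: _; apply: (slice_inj qnumS_neq0) => i j.
have /ffunP/(_ I) := E b i j; rewrite !ffunE !linearZ /=.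
by apply: scalerI; rewrite signr_eq0.
Qed.

(** The sign is the cost of moving e_a past the e_max in front of B. Contraction by e_a anticommutes
    with e_max likewise, hence the same sign in [part_contr_lift]. *)
Lemma part_ext_lift b i j a f :
  part b i j (ext (lift ord_max a) f) = (-1) ^+ b *: ext a (part b i j f).
Proof.
apply/ffunP => I; rewrite [RHS]ffunE [LHS]ffunE !extE in_topset.
case: ifPn => aI; last by rewrite !scaler0 linear0.
rewrite ffunE -topsetD1 esign_topset_lift (cardsD1 a I) aI !linearZ /= !scalerA.
by congr (_ *: _); rewrite mulnDr muln1 exprD mulrC [X in _ * X]mulrC mulrA.
Qed.

Lemma part_contr_lift b i j a f :
  part b i j (contr (lift ord_max a) f) = (-1) ^+ b *: contr a (part b i j f).
Proof.
apply/ffunP => I; rewrite [RHS]ffunE [LHS]ffunE !contrE in_topset.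
case: ifPn => aI; first by rewrite !scaler0 linear0.
rewrite ffunE -topsetU1 esign_topset_lift cardsU1 aI !linearZ /= !scalerA.
congr (_ *: _); rewrite mulnDr muln1 exprD mulrC -mulrA; congr (_ * _).
by rewrite mulrAC -expr2 sqrr_sign mul1r.
Qed.

(** e_max (A + e_max B) = e_max A. *)
Lemma part_ext_max b i j f :
  part b i j (ext ord_max f) = if b then part false i j f else 0.
Proof.
apply/ffunP => I; rewrite [LHS]ffunE extE in_topset; case: b.
  by rewrite topsetT_D1 esign_topset_max ffunE mul1n mul0n scale1r scalerA -expr2 sqrr_sign scale1r.
by rewrite scaler0 linear0 ffunE.
Qed.

(** Contraction by e_max kills A and sends e_max B to B. *)
Lemma part_contr_max b i j f :
  part b i j (contr ord_max f) = if b then 0 else part true i j f.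
Proof.
apply/ffunP => I; rewrite [LHS]ffunE contrE in_topset; case: b.
  by rewrite scaler0 linear0 ffunE.
by rewrite topsetF_U1 esign_topset_max ffunE mul1n mul0n scale1r.
Qed.

Lemma part_qder_zmax b i j f : part b i j (qder q (zvar ord_max) f) = part b i.+1 j f.
Proof. by apply/ffunP => I; rewrite [LHS]ffunE [RHS]ffunE qderE [LHS]linearZ [RHS]linearZ /= slice_qderiv_zmax. Qed.
Lemma part_qder_wmax b i j f : part b i j (qder q (wvar ord_max) f) = part b i j.+1 f.
Proof. by apply/ffunP => I; rewrite [LHS]ffunE [RHS]ffunE qderE [LHS]linearZ [RHS]linearZ /= slice_qderiv_wmax. Qed.
Lemma part_qder_zlift b i j a f :
  part b i j (qder q (zvar (lift ord_max a)) f) = qder q (zvar a) (part b i j f).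
Proof. 
apply/ffunP => I; rewrite [LHS]ffunE [RHS]qderE [in RHS]ffunE qderE [LHS]linearZ /=.
by rewrite slice_qderiv_zlift [X in _ = qderiv _ _ X]linearZ [RHS]linearZ.
 Qed.
Lemma part_qder_wlift b i j a f :
  part b i j (qder q (wvar (lift ord_max a)) f) = qder q (wvar a) (part b i j f).
Proof. 
apply/ffunP => I; rewrite [LHS]ffunE [RHS]qderE [in RHS]ffunE qderE [LHS]linearZ /=.
by rewrite slice_qderiv_wlift [X in _ = qderiv _ _ X]linearZ [RHS]linearZ.
 Qed.

(** In parts: D f = D' A + e_max (D_(z_max) A - D' B), where D_(z_max) raises the index i. *)
Lemma part_qDirac b i j f : part b i j (qDirac q f) =
  (-1) ^+ b *: qDirac q (part b i j f) + if b then part false i.+1 j f else 0.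
Proof.
rewrite [X in part b i j X]qDiracE [LHS]linear_sum [LHS]big_lift_max /=.
congr (_ + _); last by rewrite part_ext_max part_qder_zmax.
rewrite [X in _ *: X]qDiracE scaler_sumr; apply: eq_bigr => a _.
by rewrite part_ext_lift part_qder_zlift.
Qed.

(** In parts: D^+ f = (D'^+ A + D_(w_max) B) - e_max D'^+ B, where D_(w_max) raises the index j. *)
Lemma part_qDiracDag b i j f : part b i j (qDiracDag q f) =
  (-1) ^+ b *: qDiracDag q (part b i j f) + if b then 0 else part true i j.+1 f.
Proof.
rewrite [X in part b i j X]qDiracDagE [LHS]linear_sum [LHS]big_lift_max /=.
congr (_ + _); last by rewrite part_contr_max part_qder_wmax.
rewrite [X in _ *: X]qDiracDagE scaler_sumr; apply: eq_bigr => a _.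
by rewrite part_contr_lift part_qder_wlift.
Qed.

Lemma qDirac_parts f : qDirac q f = 0 <->
  forall i j, qDirac q (part false i j f) = 0 /\
              part false i.+1 j f = qDirac q (part true i j f).
Proof.
split=> [Df i j|Df].
  split; first by have := part_qDirac false i j f; rewrite Df linear0 scale1r addr0.
  have := part_qDirac true i j f; rewrite Df linear0 scaleN1r => /esym/eqP.
  by rewrite addrC subr_eq0 => /eqP.
apply: part_inj => -[] i j; rewrite part_qDirac linear0; have [D1 D2] := Df i j.
  by rewrite D2 scaleN1r addNr.
by rewrite D1 scaler0 addr0.
Qed.

Lemma qDiracDag_parts f : qDiracDag q f = 0 <->
  forall i j, qDiracDag q (part true i j f) = 0 /\
              part true i j.+1 f = - qDiracDag q (part false i j f).
Proof.
split=> [Df i j|Df].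
  split.
    have := part_qDiracDag true i j f; rewrite Df linear0 scaleN1r addr0.
    by move/esym/eqP; rewrite oppr_eq0 => /eqP.
  have := part_qDiracDag false i j f; rewrite Df linear0 scale1r => /esym/eqP.
  by rewrite addrC addr_eq0 => /eqP.
apply: part_inj => -[] i j; rewrite part_qDiracDag linear0; have [D1 D2] := Df i j.
  by rewrite D1 scaler0 addr0.
by rewrite D2 scale1r addrN.
Qed.

End Parts.

(** * Bidegree and spin degree; finite dimensionality *)

Section Grading.
Variable C : numClosedFieldType.

Definition zdeg m (k : 'X_{1..m + m}) : nat := \sum_(a < m) k (zvar a).
Definition wdeg m (k : 'X_{1..m + m}) : nat := \sum_(a < m) k (wvar a).

(* [in_P] with integer bidegrees, so that lowering a degree needs no case analysis. *)
Definition graded m (n r s : int) (f : extpoly C m m) : Prop :=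
  forall I k, (f I)@_k != 0 -> [/\ (zdeg k)%:Z = r, (wdeg k)%:Z = s & (#|I|)%:Z = n].

Lemma in_P_graded m n (r s : nat) (f : extpoly C m m) : in_P n r s f <-> graded n r s f.
Proof.
split=> [Pf I k fk|gf I].
  have [bihom cardI] := Pf I; rewrite -mcoeff_msupp in fk.
  have [zk wk] := bihom k fk; rewrite /zdeg /wdeg zk wk cardI //.
  by apply: contraTneq fk => ->; rewrite msupp0.
(* The leading monomial of a nonzero component provides the nonzero coefficient to which [graded]
   applies. *)
split=> [k|/mlead_supp]; rewrite mcoeff_msupp => /gf[].
  by move=> [zk] [wk] _.
by [].
Qed.

Lemma zdegD1z m (k : 'X_{1..m + m}) a : zdeg (k + U_(zvar a)) = (zdeg k).+1.
Proof.
rewrite /zdeg (bigD1 a) //= [in RHS](bigD1 a) //= mnmDE mnm1E eqxx addn1 addSn.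
congr (_ + _).+1; apply: eq_bigr => b ba.
by rewrite mnmDE mnm1E eq_zvar eq_sym (negbTE ba) addn0.
Qed.
Lemma wdegD1w m (k : 'X_{1..m + m}) a : wdeg (k + U_(wvar a)) = (wdeg k).+1.
Proof.
rewrite /wdeg (bigD1 a) //= [in RHS](bigD1 a) //= mnmDE mnm1E eqxx addn1 addSn.
congr (_ + _).+1; apply: eq_bigr => b ba.
by rewrite mnmDE mnm1E eq_wvar eq_sym (negbTE ba) addn0.
Qed.
Lemma zdegD1w m (k : 'X_{1..m + m}) a : zdeg (k + U_(wvar a)) = zdeg k.
Proof. by apply: eq_bigr => b _; rewrite mnmDE mnm1E eq_wzvar addn0. Qed.
Lemma wdegD1z m (k : 'X_{1..m + m}) a : wdeg (k + U_(zvar a)) = wdeg k.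
Proof. by apply: eq_bigr => b _; rewrite mnmDE mnm1E eq_zwvar addn0. Qed.

Lemma zdeg_extmon m i j (k : 'X_{1..m + m}) : zdeg (extmon i j k) = (zdeg k + i)%N.
Proof.
rewrite /zdeg big_lift_max /= extmonE; congr (_ + _)%N.
by apply: eq_bigr => a _; rewrite extmonE.
Qed.
Lemma wdeg_extmon m i j (k : 'X_{1..m + m}) : wdeg (extmon i j k) = (wdeg k + j)%N.
Proof.
rewrite /wdeg big_lift_max /= extmonE; congr (_ + _)%N.
by apply: eq_bigr => a _; rewrite extmonE.
Qed.

Lemma mdeg_zwdeg m (k : 'X_{1..m + m}) : mdeg k = (zdeg k + wdeg k)%N.
Proof. by rewrite mdegE big_zwvar. Qed.

Lemma graded_subspace m n r s : subspace (@graded m n r s).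
Proof.
split=> [I k|c f g gf gg I k]; first by rewrite ffunE mcoeff0 eqxx.
rewrite !ffunE mcoeffD mcoeffZ => nz.
have [f0|] := eqVneq (f I)@_k 0; last exact: gf.
by apply: gg; apply: contraNneq nz => ->; rewrite f0 mulr0 addr0.
Qed.

(** Exponents are natural numbers. This cuts the expansion off beyond i = r, as [graded_ltz_s] does
    beyond j = s. *)
Lemma graded_ltz_r m n r s (f : extpoly C m m) : r < 0 -> graded n r s f -> f = 0.
Proof.
move=> r0 gf; apply/ffunP => I; rewrite ffunE; apply/mpolyP => k; rewrite mcoeff0.
by apply/eqP; apply: contraLR r0 => /gf[<-].
Qed.
Lemma graded_ltz_s m n r s (f : extpoly C m m) : s < 0 -> graded n r s f -> f = 0.
Proof.
move=> s0 gf; apply/ffunP => I; rewrite ffunE; apply/mpolyP => k; rewrite mcoeff0.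
by apply/eqP; apply: contraLR s0 => /gf[_ <-].
Qed.

Lemma sum_neq0 (V : zmodType) m (F : 'I_m -> V) :
  \sum_a F a != 0 -> exists a, F a != 0.
Proof.
move=> nz; apply/existsP; apply: contraNT nz; rewrite negb_exists => /forallP F0.
by rewrite big1 // => a _; apply/eqP; rewrite -[_ == _]negbK F0.
Qed.

Lemma graded_qDirac m q n r s (f : extpoly C m m) :
  graded n r s f -> graded (n + 1) (r - 1) s (qDirac q f).
Proof.
move=> gf I k; have -> : qDirac q f I = \sum_a ext a (qder q (zvar a) f) I by apply: sum_ffunE.
rewrite raddf_sum /=.
move=> /sum_neq0[a]; rewrite extE qderE; case: ifP => aI; last by rewrite mcoeff0 eqxx.
rewrite mcoeffZ mcoeff_qderiv mulf_eq0 mulf_eq0 !negb_or => /and3P[_ _ /gf].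
rewrite zdegD1z wdegD1z => -[zk -> cardI]; split=> //.
  by rewrite -zk intS addrC addKr.
by rewrite (cardsD1 a) aI -cardI addrC intS.
Qed.

Lemma graded_qDiracDag m q n r s (f : extpoly C m m) :
  graded n r s f -> graded (n - 1) r (s - 1) (qDiracDag q f).
Proof.
move=> gf I k; have -> : qDiracDag q f I = \sum_a contr a (qder q (wvar a) f) I by apply: sum_ffunE.
rewrite raddf_sum /=.
move=> /sum_neq0[a]; rewrite contrE qderE; case: ifPn => aI; first by rewrite mcoeff0 eqxx.
rewrite mcoeffZ mcoeff_qderiv mulf_eq0 mulf_eq0 !negb_or => /and3P[_ _ /gf].
rewrite zdegD1w wdegD1w => -[-> wk cardI]; split=> //.
  by rewrite -wk intS addrC addKr.
by rewrite -cardI cardsU1 aI intS addrC addKr.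
Qed.

Lemma in_kerD_subspace q m n r s : subspace (@in_kerD C q m n r s).
Proof.
have [g0 gZD] := graded_subspace m n r s.
split=> [|c f g [Df /in_P_graded gf] [Dg /in_P_graded gg]].
  by split; [rewrite linear0 | apply/in_P_graded].
split; first by rewrite linearP /= Df Dg scaler0 addr0.
by apply/in_P_graded; apply: gZD.
Qed.

Lemma in_kerDdag_subspace q m n r s : subspace (@in_kerDdag C q m n r s).
Proof.
have [g0 gZD] := graded_subspace m n r s.
split=> [|c f g [Df /in_P_graded gf] [Dg /in_P_graded gg]].
  by split; [rewrite linear0 | apply/in_P_graded].
split; first by rewrite linearP /= Df Dg scaler0 addr0.
by apply/in_P_graded; apply: gZD.
Qed.

Lemma in_M_subspace q m n r s : subspace (@in_M C q m n r s).
Proof.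
have [kD0 kDZD] := in_kerD_subspace q m n r s.
have [kd0 kdZD] := in_kerDdag_subspace q m n r s.
split=> [|c f g [Df df Pf] [Dg dg Pg]]; first by split; [case: kD0|case: kd0|case: kd0].
have [Dfg Pfg] := kDZD c f g (conj Df Pf) (conj Dg Pg).
by have [dfg _] := kdZD c f g (conj df Pf) (conj dg Pg).
Qed.

(** All monomials have total degree r + s, so finitely many coefficients determine [f], and
    [has_dim_exists] applies to the coefficient map. *)
Lemma has_dim_graded m n (r s : nat) (P : extpoly C m m -> Prop) :
  subspace P -> (forall f, P f -> graded n r s f) -> exists d, has_dim P d.
Proof.
move=> subP Pgr.
(* [bmultinom] bounds the total degree strictly, hence the successor. *)
pose T : finType := ({set 'I_m} * bmultinom (m + m) (r + s).+1)%type.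
pose idx (t : 'I_#|T|) : {set 'I_m} * bmultinom (m + m) (r + s).+1 := enum_val t.
pose coefs (f : extpoly C m m) : 'rV[C]_#|T| :=
  \row_t (f (idx t).1)@_(idx t).2.
have coefs_lin : linear coefs.
  by move=> c f g; apply/rowP => t; rewrite !mxE !ffunE mcoeffD mcoeffZ.
pose phi : {linear extpoly C m m -> 'rV[C]_#|T|} :=
  HB.pack coefs (GRing.isLinear.Build C (extpoly C m m) 'rV[C]_#|T| *:%R coefs coefs_lin).
apply: (has_dim_exists (phi := phi)) => // f /Pgr gf /rowP f0.
apply/ffunP => I; rewrite ffunE; apply/mpolyP => k; rewrite mcoeff0; apply/eqP.
apply/contraT => nz; have [[zk] [wk] _] := gf _ _ nz.
have kle : (mdeg k < (r + s).+1)%N by rewrite mdeg_zwdeg zk wk.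
have := f0 (enum_rank (I, BMultinom kle)).
by rewrite !mxE /idx enum_rankK /= => /eqP; rewrite (negbTE nz).
Qed.

Variables (q : C) (m : nat).
Hypothesis qnumS_neq0 : forall k, qnum q k.+1 != 0.

Lemma mcoeff_part b i j (f : extpoly C m.+1 m.+1) I k : (part q b i j f I)@_k =
  qfact q i * qfact q j * (-1) ^+ (b * #|I|) * (f (topset b I))@_(extmon i j k).
Proof. by rewrite ffunE mcoeff_slice mcoeffZ mulrA. Qed.

Lemma graded_part (b : bool) (i j : nat) n r s (f : extpoly C m.+1 m.+1) :
  graded n r s f -> graded (n - (nat_of_bool b)%:Z) (r - i%:Z) (s - j%:Z) (part q b i j f).
Proof.
move=> gf I k; rewrite mcoeff_part mulf_eq0 negb_or => /andP[_ /gf].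
rewrite zdeg_extmon wdeg_extmon card_topset => -[<- <- <-].
by rewrite !PoszD !addrK addrAC subrr add0r.
Qed.

Lemma graded_parts n r s (f : extpoly C m.+1 m.+1) :
    (forall (b : bool) (i j : nat), graded (n - (nat_of_bool b)%:Z) (r - i%:Z) (s - j%:Z) (part q b i j f)) ->
  graded n r s f.
Proof.
move=> gf J K; rewrite -(topset_preim J) -(resmonK K).
set b := _ \in _; set I := _ @^-1: _; set i := K _; set j := K _; set k := resmon K => nz.
have /gf : (part q b i j f I)@_k != 0.
  by rewrite mcoeff_part !mulf_neq0 ?qfact_neq0 ?signr_eq0.
rewrite zdeg_extmon wdeg_extmon card_topset !PoszD => -[-> -> ->].
by rewrite !subrK [_ + (_ - _)]addrC subrK.
Qed.

End Grading.

(** * The boundary map and its inverse *)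

Section Boundary.
Variables (C : numClosedFieldType) (q : C) (m : nat).
Hypothesis qnumS_neq0 : forall k, qnum q k.+1 != 0.
Local Notation M := m.+1.
Implicit Types (f : extpoly C M M) (n : int) (r s : nat).

(** Defined on all polynomials, as a linear map has to be; only for [f] of bidegree (r, s) is the
    truncation at [s] and [r] harmless. *)
Definition boundary r s f : bdata C m r s :=
  ([ffun j : 'I_s.+1 => part q false 0 j f], [ffun i : 'I_r.+1 => part q true i 0 f]).

Fact boundary_is_linear r s : linear (boundary r s).
Proof.
move=> c f g; congr (_, _); apply/ffunP => j;
rewrite [LHS]ffunE [RHS]ffunE [X in _ = X + _]ffunE [X in _ = _ *: X + _]ffunE;
rewrite [X in _ = _ + X]ffunE; exact: linearP.
Qed.
HB.instance Definition _ r s :=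
  GRing.isLinear.Build C (extpoly C M M) (bdata C m r s) *:%R (boundary r s)
    (@boundary_is_linear r s).

Lemma boundary1E r s f j : (boundary r s f).1 j = part q false 0 j f.
Proof. exact: ffunE. Qed.
Lemma boundary2E r s f i : (boundary r s f).2 i = part q true i 0 f.
Proof. exact: ffunE. Qed.

Lemma incl_topset b (A : extpoly C M m) I : incl A (topset b I) = if b then 0 else A I.
Proof. by rewrite ffunE in_topset preim_topset. Qed.

(** Gives both existence and uniqueness of the decomposition. The sign arises because e_max has to
    pass all of e_I to reach its place in the increasing product. *)
Lemma decompP f (A B : extpoly C M m) : f = incl A + ext ord_max (incl B) <->
  forall I, A I = f (topset false I) /\ B I = (-1) ^+ #|I| *: f (topset true I).
Proof.
have decE I (b : bool) : (incl A + ext ord_max (incl B)) (topset b I) =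
    if b then (-1) ^+ #|I| *: B I else A I.
  rewrite ffunE incl_topset extE in_topset; case: b; last by rewrite addr0.
  by rewrite add0r topsetT_D1 incl_topset esign_topset_max.
split=> [-> I|AB].
  by rewrite !decE scalerA -expr2 sqrr_sign scale1r.
apply/ffunP => J; rewrite -(topset_preim J) decE.
have [-> ->] := AB (lift ord_max @^-1: J).
by case: (_ \in _); rewrite // scalerA -expr2 sqrr_sign scale1r.
Qed.

(** [oapp g 0 (insub j)] is the family [g] continued by 0 to all j > s. *)
Lemma slice0_sum_unslice s (g : 'I_s.+1 -> {mpoly C[m + m]}) i j :
  slice q i j (\sum_(j' < s.+1) unslice q 0 j' (g j')) =
    if i == 0%N then oapp g 0 (insub j) else 0.
Proof.
rewrite linear_sum /=; under eq_bigr => j' _ do rewrite slice_unslice //.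
case: eqP => _ /=; last by rewrite big1.
case: insubP => [j0 _ /= <-|js].
  rewrite (bigD1 j0) //= eqxx big1 ?addr0 // => j' /negbTE.
  by rewrite eq_sym -val_eqE /= => ->.
by rewrite big1 // => j' _; case: eqP => // E; rewrite E ltn_ord in js.
Qed.

Lemma slice_sum_unslice0 s (g : 'I_s.+1 -> {mpoly C[m + m]}) i j :
  slice q i j (\sum_(i' < s.+1) unslice q i' 0 (g i')) =
    if j == 0%N then oapp g 0 (insub i) else 0.
Proof.
rewrite linear_sum /=; under eq_bigr => i' _ do rewrite slice_unslice //.
case: eqP => _ /=; last by rewrite big1 // => i' _; rewrite andbF.
case: insubP => [i0 _ /= <-|si].
  rewrite (bigD1 i0) //= eqxx big1 ?addr0 // => i' /negbTE.
  by rewrite eq_sym -val_eqE /= andbT => ->.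
by rewrite big1 // => i' _; case: eqP => // E; rewrite E ltn_ord in si.
Qed.

Lemma part0_gt_s n r s f b i (j : nat) : graded n r%:Z s%:Z f -> (s < j)%N ->
  part q b i j f = 0.
Proof.
move=> /(graded_part (q := q) (b := b) (i := i) (j := j)) gf sj; apply: graded_ltz_s gf.
by rewrite subr_lt0 ltz_nat.
Qed.

Lemma part0_gt_r n r s f b (i : nat) j : graded n r%:Z s%:Z f -> (r < i)%N ->
  part q b i j f = 0.
Proof.
move=> /(graded_part (q := q) (b := b) (i := i) (j := j)) gf ri; apply: graded_ltz_r gf.
by rewrite subr_lt0 ltz_nat.
Qed.

(** The slices (0, j) and (i, 0) of the two expansions isolate a_j and b_i. Conversely, expansions
    stopping at [s] and [r] are complete, because all later slices have negative degree. *)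
Lemma boundary_dataP n r s f (ab : bdata C m r s) : graded n r%:Z s%:Z f ->
  boundary_data q f ab <-> ab = boundary r s f.
Proof.
move=> gf; split=> [[A [B [/decompP AB Ha Hb]]]|->].
  rewrite [ab]surjective_pairing; congr (_, _); apply/ffunP => j; apply/ffunP => I.
    have := congr1 (slice q 0 j) (Ha I).
    under eq_bigr => j' _ do rewrite qdivpoww_emb.
    rewrite slice_dilate0z slice0_sum_unslice /= valK /= => <-.
    by rewrite !ffunE scale1r; have [->] := AB I.
  have := congr1 (slice q j 0) (Hb I).
  under eq_bigr => j' _ do rewrite qdivpowz_emb.
  rewrite slice_dilate0w slice_sum_unslice0 /= valK /= => <-.
  by rewrite !ffunE mul1n; have [_ ->] := AB I.
exists [ffun I : {set 'I_m} => f (topset false I)],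
  [ffun I : {set 'I_m} => (-1) ^+ #|I| *: f (topset true I)].
split=> [|I|I].
- by apply/decompP => I; rewrite !ffunE.
- under eq_bigr => j' _ do rewrite qdivpoww_emb.
  apply: (slice_inj qnumS_neq0) => i j.
  rewrite slice_dilate0z slice0_sum_unslice; case: eqP => // ->.
  have -> : slice q 0 j ([ffun I : {set 'I_m} => f (topset false I)] I) = part q false 0 j f I.
    by rewrite !ffunE scale1r.
  case: insubP => [j0 _ /= <-|js]; first exact: (congr1 (fun_of_fin^~ I) (esym (boundary1E r f j0))).
  by rewrite /= (part0_gt_s _ _ gf) ?ffunE // ltnNge -ltnS.
- under eq_bigr => j' _ do rewrite qdivpowz_emb.
  apply: (slice_inj qnumS_neq0) => i j.
  rewrite slice_dilate0w slice_sum_unslice0; case: eqP => // ->.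
  have -> : slice q i 0 ([ffun I : {set 'I_m} => (-1) ^+ #|I| *: f (topset true I)] I) =
      part q true i 0 f I.
    by rewrite !ffunE mul1n.
  case: insubP => [i0 _ /= <-|ri]; first exact: (congr1 (fun_of_fin^~ I) (esym (boundary2E s f i0))).
  by rewrite /= (part0_gt_r _ _ gf) ?ffunE // ltnNge -ltnS.
Qed.

Lemma boundary_target_of_M n r s f :
  in_M q n r s f -> boundary_target q n (boundary r s f).
Proof.
move=> [/(qDirac_parts qnumS_neq0) Df /(qDiracDag_parts qnumS_neq0) df /in_P_graded gf].
split=> i; rewrite ffunE; split.
- by case: (Df 0%N i).
- apply/in_P_graded; have := graded_part (q := q) (b := false) (i := 0%N) (j := i) gf.
  by rewrite !subr0 subzn // -ltnS.
- by case: (df i 0%N).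
- apply/in_P_graded; have := graded_part (q := q) (b := true) (i := i) (j := 0%N) gf.
  by rewrite !subr0 subzn // -ltnS.
Qed.

Lemma boundary_inj n r s f g : in_M q n r s f -> in_M q n r s g ->
  boundary r s f = boundary r s g -> f = g.
Proof.
move=> [/(qDirac_parts qnumS_neq0) Df /(qDiracDag_parts qnumS_neq0) df /in_P_graded gf].
move=> [/(qDirac_parts qnumS_neq0) Dg /(qDiracDag_parts qnumS_neq0) dg /in_P_graded gg].
move=> [/ffunP Ea /ffunP Eb].
have E0 j : part q false 0 j f = part q false 0 j g.
  have [js|js] := ltnP s j; first by rewrite (part0_gt_s _ _ gf) // (part0_gt_s _ _ gg).
  by have := Ea (inord j); rewrite !ffunE inordK.
have E1 i : part q true i 0 f = part q true i 0 g.
  have [ri|ri] := ltnP r i; first by rewrite (part0_gt_r _ _ gf) // (part0_gt_r _ _ gg).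
  by have := Eb (inord i); rewrite !ffunE inordK.
(* Off the boundary, each recursion equation lowers i + j by one while passing from A to B or back,
   so both families are treated in one induction. *)
have E N i j : (i + j <= N)%N -> part q false i j f = part q false i j g /\
    part q true i j f = part q true i j g.
  elim: N i j => [|N IHN] i j.
    by rewrite leqn0 addn_eq0 => /andP[/eqP-> /eqP->].
  move=> ijN; split.
    case: i ijN => [|i] ijN //; have [_ ->] := Df i j; have [_ ->] := Dg i j.
    by have [_ ->] := IHN i j ijN.
  case: j ijN => [|j] ijN //; have [_ ->] := df i j; have [_ ->] := dg i j.
  by have [-> _] := IHN i j (leq_trans (eq_leq (esym (addnS i j))) ijN).
apply: (part_inj qnumS_neq0) => b i j; have [EA EB] := E _ i j (leqnn _).
by case: b.
Qed.

(* The equations [A_(i+1,j) = D' B_(i,j)] and [B_(i,j+1) = - D'^+ A_(i,j)]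
   determine all parts from the boundary parts [A_(0,j)] and [B_(i,0)]. *)
Fixpoint solA (a b : nat -> extpoly C m m) (i j : nat) : extpoly C m m :=
  match i, j with
  | 0, _ => a j
  | i'.+1, 0 => qDirac q (b i')
  | i'.+1, j'.+1 => qDirac q (- qDiracDag q (solA a b i' j'))
  end.

Definition solB (a b : nat -> extpoly C m m) (i j : nat) : extpoly C m m :=
  if j is j'.+1 then - qDiracDag q (solA a b i j') else b i.

(** In [solA] the value of [solB] is written out, so that one structural recursion replaces a mutual
    one; this restores the intended equation. *)
Lemma solAS a b i j : solA a b i.+1 j = qDirac q (solB a b i j).
Proof. by case: j. Qed.

Lemma boundary_surj n r s (ab : bdata C m r s) : boundary_target q n ab ->
  exists2 f, in_M q n r s f & boundary r s f = ab.
Proof.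
move=> [Ha Hb].
(* Continuing the data by 0 lets the recursion run over all i and j; 0 satisfies the kernel
   equations and has every degree. *)
pose a j := oapp ab.1 0 (insub j); pose b i := oapp ab.2 0 (insub i).
have Da j : qDirac q (a j) = 0.
  by rewrite /a; case: insubP => [j0 _ _|_] /=; [case: (Ha j0) | rewrite linear0].
have db i : qDiracDag q (b i) = 0.
  by rewrite /b; case: insubP => [i0 _ _|_] /=; [case: (Hb i0) | rewrite linear0].
have ga (j : nat) : graded n r%:Z (s%:Z - j%:Z) (a j).
  rewrite /a; case: insubP => [j0 js /= <-|_] /=; last by case: (graded_subspace C m n r (s%:Z - j%:Z)).
  have [_ /in_P_graded] := Ha j0; by rewrite subzn // -ltnS.
have gb (i : nat) : graded (n - 1) (r%:Z - i%:Z) s%:Z (b i).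
  rewrite /b; case: insubP => [i0 ri /= <-|_] /=; last by case: (graded_subspace C m (n - 1) (r%:Z - i%:Z) s).
  have [_ /in_P_graded] := Hb i0; by rewrite subzn // -ltnS.
have subzS (x : int) (k : nat) : x - k.+1%:Z = x - k%:Z - 1.
  by rewrite intS opprD addrCA addrC.
pose A := solA a b; pose B := solB a b.
(* The degrees fit: D' turns the spin degree n - 1 of B into n and lowers the z-degree, and D'^+
   turns n into n - 1 and lowers the w-degree. *)
have gAB N (i j : nat) : (i + j <= N)%N ->
    graded n (r%:Z - i%:Z) (s%:Z - j%:Z) (A i j) /\
    graded (n - 1) (r%:Z - i%:Z) (s%:Z - j%:Z) (B i j).
  elim: N i j => [|N IHN] i j.
    rewrite leqn0 addn_eq0 => /andP[/eqP-> /eqP->]; split.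
      by have := ga 0%N; rewrite !subr0.
    by have := gb 0%N; rewrite !subr0.
  move=> ijN; split.
    case: i ijN => [|i] ijN; first by rewrite subr0; apply: ga.
    rewrite /A solAS; have [_ gB] := IHN i j ijN.
    by have := graded_qDirac (q := q) gB; rewrite subrK subzS.
  case: j ijN => [|j] ijN; first by rewrite subr0; apply: gb.
  rewrite addnS in ijN; have [gA _] := IHN i j ijN.
  have [_ gZD] := graded_subspace C m (n - 1) (r%:Z - i%:Z) (s%:Z - j.+1%:Z).
  rewrite /B /= -scaleN1r -[_ *: _]addr0; apply: gZD.
    by have := graded_qDiracDag (q := q) gA; rewrite -subzS.
  by case: (graded_subspace C m (n - 1) (r%:Z - i%:Z) (s%:Z - j.+1%:Z)).
have gA (i j : nat) : graded n (r%:Z - i%:Z) (s%:Z - j%:Z) (A i j).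
  by case: (gAB _ i j (leqnn _)).
have gB (i j : nat) : graded (n - 1) (r%:Z - i%:Z) (s%:Z - j%:Z) (B i j).
  by case: (gAB _ i j (leqnn _)).
have DA i j : qDirac q (A i j) = 0.
  by case: i => [|i]; [apply: Da | rewrite /A solAS qDirac_qDirac].
have dB i j : qDiracDag q (B i j) = 0.
  by case: j => [|j]; [apply: db | rewrite /B /= linearN /= qDiracDag_qDiracDag oppr0].
pose X (c : bool) := if c then B else A.
have X0r c i j : (r < i)%N -> X c i j = 0.
  rewrite -ltz_nat -subr_lt0 => ri.
  by case: c; [apply: graded_ltz_r (gB i j) | apply: graded_ltz_r (gA i j)].
have X0s c i j : (s < j)%N -> X c i j = 0.
  rewrite -ltz_nat -subr_lt0 => sj.
  by case: c; [apply: graded_ltz_s (gB i j) | apply: graded_ltz_s (gA i j)].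
(* By the two vanishing statements above, the finite sum loses no term. The sign cancels the one
   built into [part]. *)
pose f : extpoly C M M := [ffun J : {set 'I_M} => let I := lift ord_max @^-1: J in
  \sum_(i < r.+1) \sum_(j < s.+1)
     unslice q i j ((-1) ^+ ((ord_max \in J) * #|I|) *: X (ord_max \in J) i j I)].
have partX c (i j : nat) : part q c i j f = X c i j.
  apply/ffunP => I; rewrite [LHS]ffunE [in LHS]ffunE in_topset preim_topset.
  rewrite [LHS]linearZ /= [slice _ _ _ _]linear_sum /=.
  have sliceE (i' : 'I_r.+1) :
    slice q i j (\sum_(j' < s.+1) unslice q i' j' ((-1) ^+ (c * #|I|) *: X c i' j' I)) =
    if i == i' then (-1) ^+ (c * #|I|) *: X c i j I else 0.
    rewrite linear_sum /=; under eq_bigr => j' _ do rewrite slice_unslice //.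
    case: eqP => [->|_] /=; last by rewrite big1.
    have [js|sj] := leqP j s.
      rewrite (bigD1 (inord j)) //= inordK // eqxx big1 ?addr0 // => j' /negbTE.
      by rewrite -val_eqE /= inordK // eq_sym => ->.
    rewrite big1 => [|j' _]; last first.
      by case: eqP => // E; move: sj; rewrite E ltnNge -ltnS ltn_ord.
    by rewrite X0s // ffunE scaler0.
  under eq_bigr => i' _ do rewrite sliceE.
  have [ir|ri] := leqP i r.
    rewrite (bigD1 (inord i)) //= inordK // eqxx big1 ?addr0 => [|i' /negbTE].
      by rewrite scalerA -expr2 sqrr_sign scale1r.
    by rewrite -val_eqE /= inordK // eq_sym => ->.
  rewrite X0r // big1 ?scaler0 ?ffunE // => i' _.
  by case: eqP ri => // ->; rewrite ltnNge -ltnS ltn_ord.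
exists f.
  split.
  - apply/(qDirac_parts qnumS_neq0) => i j; rewrite !partX.
    by split; [apply: DA | apply: solAS].
  - apply/(qDiracDag_parts qnumS_neq0) => i j; rewrite !partX.
    by split; [apply: dB |].
  - apply/in_P_graded/(graded_parts qnumS_neq0) => c i j; rewrite partX.
    by case: c; [apply: gB | rewrite subr0; apply: gA].
rewrite [RHS]surjective_pairing; congr (_, _); apply/ffunP => j; rewrite ffunE partX.
  by rewrite /= /A /= /a valK.
by rewrite /= /B /= /b valK.
Qed.

Lemma boundary_iso n r s :
  linear_iso (@in_M C q M n r s) (@boundary_target C q m n r s) (boundary r s).
Proof.
split; [exact: boundary_target_of_M | exact: boundary_inj | exact: boundary_surj].
Qed.

End Boundary.

(** The m >= 1 of the informal statement is [m.+1] here, so the spaces over its first m - 1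
    coordinate pairs are those over [m] pairs. *)
Theorem corollary4p2 (R : realType) (m : nat) (q : R) (r s n : nat)
    (q_gt0 : 0 < q) (q_lt1 : q < 1) (n_le : (n <= m.+1)%N) :
  let qC : R[i] := q%:C%C in
  (exists Phi : {linear extpoly R[i] m.+1 m.+1 -> bdata R[i] m r s},
     (forall f, in_M qC n%:Z r s f ->
        forall ab, boundary_data qC f ab <-> ab = Phi f) /\
     linear_iso (@in_M R[i] qC m.+1 n%:Z r s)
                (@boundary_target R[i] qC m n%:Z r s) Phi) /\
  (exists (d : nat) (da : 'I_s.+1 -> nat) (db : 'I_r.+1 -> nat),
     [/\ has_dim (@in_M R[i] qC m.+1 n%:Z r s) d,
         forall j : 'I_s.+1,
           has_dim (@in_kerD R[i] qC m n%:Z r (s - j)) (da j),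
         forall i : 'I_r.+1,
           has_dim (@in_kerDdag R[i] qC m (n%:Z - 1) (r - i) s) (db i)
       & d = (\sum_(j < s.+1) da j + \sum_(i < r.+1) db i)%N]).
Proof.
move=> qC.
(* For e > 0, q^e < 1 in the real field, so 1 - q^e is nonzero, and the embedding into the complex
   numbers preserves this. *)
have qnumS_neq0 k : qnum qC k.+1 != 0.
  have fix1 e : 1 - qC ^+ e = (1 - q ^+ e)%:C%C by rewrite rmorphB rmorph1 rmorphXn.
  have neq e : (0 < e)%N -> 1 - qC ^+ e != 0.
    move=> e0; rewrite fix1 fmorph_eq0 subr_eq0 eq_sym lt_eqF // exprn_ilt1 ?ltW //.
    by rewrite -lt0n.
  by rewrite /qnum mulf_neq0 ?neq // invr_eq0 -[X in 1 - X]expr1 neq.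
have iso := boundary_iso m qnumS_neq0 n%:Z r s.
split.
  exists (boundary qC r s : {linear _ -> _}); split=> // f [_ _ /in_P_graded gf] ab.
  exact: boundary_dataP gf.
have /choice[da Hda] (j : 'I_s.+1) : exists d, has_dim (@in_kerD R[i] qC m n%:Z r (s - j)) d.
  apply: (has_dim_graded (in_kerD_subspace qC m n%:Z r (s - j))) => f [_ Pf].
  exact/in_P_graded/Pf.
have /choice[db Hdb] (i : 'I_r.+1) :
    exists d, has_dim (@in_kerDdag R[i] qC m (n%:Z - 1) (r - i) s) d.
  apply: (has_dim_graded (in_kerDdag_subspace qC m (n%:Z - 1) (r - i) s)) => f [_ Pf].
  exact/in_P_graded/Pf.
exists (\sum_(j < s.+1) da j + \sum_(i < r.+1) db i)%N, da, db; split=> //.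
(* The dimension is computed on the target, where it is a sum over the components, and carried back
   along the boundary isomorphism. *)
apply: (has_dim_iso (in_M_subspace qC m.+1 n%:Z r s) iso).
exact: (has_dim_pair (has_dim_ffun Hda) (has_dim_ffun Hdb)).
Qed.
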